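(* If a discrete group $\Gamma$ has the property of special symbol, then $\Gamma$ is finitely generated.
   Context: Let $\Gamma$ be a discrete group and $\mathcal{A}$ a finite discrete set (alphabet). $\mathcal{A}^{\Gamma}$ carries the product topology and the left $\Gamma$-action $(\gamma\sigma)(g)=\sigma(\gamma^{-1}g)$. A cylinder is a set $\mathcal{C}=\{\sigma\in\mathcal{A}^\Gamma : \sigma|_F\in M\}$, where $F\subset\Gamma$ is finite and $M\subset\mathcal{A}^F$. A subshift of finite type is a set of the form $\Phi=\bigcap_{\gamma\in\Gamma}\gamma^{-1}\mathcal{C}$ with $\mathcal{C}$ a cylinder. An action of $\Gamma$ on a compact space $K$ is *of finite type* if there are a finite alphabet $\mathcal{A}$, a subshift of finite type $\Phi\subset\mathcal{A}^\Gamma$ and a continuous surjective $\Gamma$-equivariant map $\pi:\Phi\to K$. It is *expansive* if there is a neighbourhood $U$ of the diagonal $\Delta\subset K\times K$ with $\Delta=\bigcap_{\gamma\in\Gamma}\gamma U$. It is *finitely presented* if it is both of finite type and expansive. Let $\hat \Gamma=\Gamma\cup\{\infty\}$ be the one-point compactification if $\Gamma$ is infinite and $\hat \Gamma=\Gamma$ if $\Gamma$ is finite; $\Gamma$ acts by left multiplication on $\Gamma$, fixing $\infty$. $\Gamma$ has *the property of special symbol* if the action of $\Gamma$ on $\hat \Gamma$ is finitely presented, by a subshift of finite type $\Phi\subset\mathcal{A}^\Gamma$ and a continuous surjective equivariant map $\pi:\Phi\to\hat \Gamma$ for which there is a symbol $\$\in\mathcal{A}$ such that, for all $\sigma\in\Phi$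 and $\gamma\in \Gamma$, $\pi(\sigma)=\gamma$ if and only if $\sigma(\gamma)=\$$. *)

(* Defs.v *)
From mathcomp Require Import all_boot.
From mathcomp Require Import boolp classical_sets functions cardinality.
From mathcomp Require Import topology.

Set Implicit Arguments.
Unset Strict Implicit.
Unset Printing Implicit Defensive.

Local Open Scope classical_set_scope.
Local Open Scope group_scope.

(* MathComp's groupType, from mathcomp.boot.monoid, does not assume
   finiteness. Topologies on groups and alphabets go through the library alias
   discrete_topology, so they are always discrete. *)

Notation config G A := {ptws G -> discrete_topology A}.

Section Subshifts.
Context {G : groupType} {A : finType}.

Definition shift (g : G) (s : config G A) : config G A := fun h => s (g^-1 * h).

(* [sigL F s] is the restriction of s to the subtype of elements of F. *)
Definition is_cylinder (C : set (config G A)) : Prop :=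
  exists (F : set G) (M : set (F -> A)),
    finite_set F /\ C = [set s | M (sigL F s)].

Definition is_sft (Phi : set (config G A)) : Prop :=
  exists2 C, is_cylinder C &
    Phi = \bigcap_(g in [set: G]) (shift g^-1 @` C).

End Subshifts.

Section Actions.
Context {G : groupType} {K : topologicalType}.
Variable act : G -> K -> K.

(* The factor map is a total function on the full shift, of which only the
   restriction to Phi matters. *)
Definition is_factor_map {A : finType} (Phi : set (config G A))
    (pi : config G A -> K) : Prop :=
  [/\ {within Phi, continuous pi},
      pi @` Phi = [set: K]
    & forall (g : G) (s : config G A), Phi s -> pi (shift g s) = act g (pi s)].

Definition of_finite_type : Prop :=
  exists (A : finType) (Phi : set (config G A)) (pi : config G A -> K),
    is_sft Phi /\ is_factor_map Phi pi.

Definition expansive : Prop :=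
  exists2 U : set (K * K), set_nbhs diagonal U &
    diagonal = \bigcap_(g in [set: G])
                 ((fun p : K * K => (act g p.1, act g p.2)) @` U).

Definition finitely_presented : Prop := of_finite_type /\ expansive.

(* [iota] is the inclusion of G into K. *)
Definition special_symbol_for (iota : G -> K) : Prop :=
  finitely_presented /\
  exists (A : finType) (Phi : set (config G A)) (pi : config G A -> K)
      (dollar : A),
    [/\ is_sft Phi,
        is_factor_map Phi pi
      & forall (s : config G A) (g : G), Phi s ->
          (pi s = iota g <-> s g = dollar)].

End Actions.

Definition lmul_discrete (G : groupType) (g : G) (x : discrete_topology G) :
  discrete_topology G := g * (x : G).

Definition lmul_opc (G : groupType) (g : G)
    (x : one_point_compactification (discrete_topology G)) :
    one_point_compactification (discrete_topology G) :=
  omap (lmul_discrete g) x.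

(* The library's one-point compactification of a finite discrete space has an
   extra isolated point, whereas hat(G) is G itself for finite G: hence the
   case distinction. *)
Definition special_symbol (G : groupType) : Prop :=
  if pselect (finite_set [set: G])
  then special_symbol_for (@lmul_discrete G) (fun g : G => g)
  else special_symbol_for (@lmul_opc G) (fun g : G => Some g).

Definition generated_subgroup (G : groupType) (S : set G) : set G :=
  smallest (fun H : set G => group_closed (mem H)) S.

Definition finitely_generated (G : groupType) : Prop :=
  exists2 S : set G, finite_set S & generated_subgroup S = [set: G].

(* Main.v *)
Require Import Defs.
From mathcomp Require Import all_boot.
From mathcomp Require Import boolp classical_sets functions cardinality.
From mathcomp Require Import topology.

(** The special symbol occurs at most once in each configuration of the
    subshift, namely at the group element to which the configuration projects, if any,
    and surjectivity of the projection gives, for each group element g, a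
    configuration carrying the symbol at g.  Let F be a finite window defining
    the subshift and let H be the subgroup that F generates.  Each translate
    g F lies in the single coset g H, so the local constraints never relate two
    different cosets of H, and configurations of the subshift can be cut and
    pasted freely along H ([sft_splice]).  If some g were outside H, pasting a
    configuration with the symbol at 1 on H with one with the symbol at g off H
    would put the symbol at two places.  Hence H is the whole group.

    If the group is infinite, a configuration carrying the symbol at g projects
    to the point [Some g] of the compactification; if it is finite, to g itself.
    In both cases distinct group elements are distinct points, so two
    occurrences of the symbol are contradictory. *)

Set Implicit Arguments.
Unset Strict Implicit.
Unset Printing Implicit Defensive.

Local Open Scope classical_set_scope.
Local Open Scope group_scope.

Lemma generated_subgroup_closed (G : groupType) (S : set G) :
  group_closed (mem (generated_subgroup S)).
Proof.
split; first by apply/mem_set => H [[H1 _] _]; exact/set_mem.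
move=> x y /set_mem Sx /set_mem Sy; apply/mem_set => H HP.
by case: (HP) => -[_ HB] _; apply/set_mem/HB; apply/mem_set; [exact: Sx|exact: Sy].
Qed.

Lemma sub_generated_subgroup (G : groupType) (S : set G) :
  S `<=` generated_subgroup S.
Proof. exact: sub_smallest. Qed.

Section Subshift.
Context {G : groupType} {A : finType}.
Implicit Types (s t : config G A) (H F : set G).

Lemma shiftK (g : G) : cancel (@shift G A g) (shift g^-1).
Proof. by move=> s; apply/funext => h; rewrite /shift invgK mulKg. Qed.

Lemma shiftVK (g : G) : cancel (@shift G A g^-1) (shift g).
Proof. by move=> s; apply/funext => h; rewrite /shift invgK mulVKg. Qed.

Lemma mem_bigcap_shift (C : set (config G A)) s :
  (\bigcap_(g in [set: G]) (shift g^-1 @` C)) s <-> forall g, C (shift g s).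
Proof.
split=> [sP g|sP g _]; last by exists (shift g s); rewrite ?shiftK.
by have [c Cc <-] := sP g I; rewrite shiftVK.
Qed.

Definition splice H s t : config G A := fun x => if x \in H then s x else t x.

Lemma group_closed_mulr H x h : group_closed (mem H) -> h \in H ->
  (x * h \in H) = (x \in H).
Proof.
move=> HP hH; have HM := group_closedM HP; have HV := group_closedV HP.
apply/idP/idP => xH; last exact: HM.
by rewrite -(mulgK h x); apply: HM => //; exact: HV.
Qed.

(** A translate of the window lies in a single coset of H, so the spliced
    configuration agrees there with s throughout or with t throughout. *)
Lemma sft_splice H F (M : set (F -> A)) (Phi : set (config G A)) s t :
  group_closed (mem H) -> F `<=` H ->
  Phi = \bigcap_(g in [set: G]) (shift g^-1 @` [set u | M (sigL F u)]) ->
  Phi s -> Phi t -> Phi (splice H s t).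
Proof.
move=> HP FH -> /mem_bigcap_shift Ms /mem_bigcap_shift Mt.
apply/mem_bigcap_shift => g /=.
have window_coset (x : F) : (g^-1 * val x \in H) = (g^-1 \in H).
  by apply: group_closed_mulr => //; apply/mem_set/FH/set_valP.
have [gH|gH] := boolP (g^-1 \in H).
- have -> : sigL F (shift g (splice H s t)) = sigL F (shift g s); last exact: Ms.
  by apply/funext => x; rewrite /sigL /= /shift /splice window_coset gH.
- have -> : sigL F (shift g (splice H s t)) = sigL F (shift g t); last exact: Mt.
  by apply/funext => x; rewrite /sigL /= /shift /splice window_coset (negbTE gH).
Qed.

End Subshift.

Lemma special_symbol_for_finitely_generated (G : groupType)
    (K : topologicalType) (act : G -> K -> K) (iota : G -> K) :
  injective iota -> special_symbol_for act iota -> finitely_generated G.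
Proof.
move=> iota_inj [_ [A [Phi [pi [dollar]]]]].
case=> -[C [F [M [Ffin CE]]]]; rewrite {}CE => PhiE [_ pi_surj _] dollarP.
exists F => //; apply/seteqP; split=> // g _; apply: contrapT => gNH.
set H := generated_subgroup F in gNH *.
have HP : group_closed (mem H) := generated_subgroup_closed F.
have symbol_at h : exists2 s, Phi s & s h = dollar.
  have [s Phis pis] : (pi @` Phi) (iota h) by rewrite pi_surj.
  by exists s => //; apply/(dollarP s h Phis).
have [s Phis s1] := symbol_at 1; have [t Phit tg] := symbol_at g.
have Phiu : Phi (splice H s t).
  exact: (sft_splice HP (@sub_generated_subgroup _ F) PhiE Phis Phit).
have H1 : 1 \in H := proj1 HP.
have /(dollarP _ _ Phiu) pi1 : splice H s t 1 = dollar by rewrite /splice H1.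
have /(dollarP _ _ Phiu) pig : splice H s t g = dollar.
  by rewrite /splice memNset.
have g1 : g = 1 by apply: iota_inj; rewrite -pig -pi1.
by apply: gNH; rewrite g1; exact/set_mem.
Qed.

Theorem theorem0p2 (G : groupType) : special_symbol G -> finitely_generated G.
Proof.
rewrite /special_symbol; case: pselect => ? /=.
  by apply: (@special_symbol_for_finitely_generated _ (discrete_topology G)).
by apply: special_symbol_for_finitely_generated => x y [].
Qed.
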